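(* Let $x:\mathbb{R}\to E_v^n$ be a unit speed non-null curve in the Minkowski space-time $E_v^n$ with Serre-Frenet frame $\{\vec V_1(s),\dots,\vec V_n(s)\}$, signs $\varepsilon_i=\langle \vec V_i,\vec V_i\rangle=\pm1$, and curvatures $k_1(s),k_2(s),\dots,k_{n-1}(s)$. Let $\omega>0$ and suppose that $k_1,\dots,k_{n-1}$ are continuous periodic functions of period $\omega$. Let $A(s)=(a_{ij}(s))$ be the $n\times n$ matrix with $$a_{i,i+1}(s)=\varepsilon_i k_i(s)\ (1\le i\le n-1),\qquad a_{i,i-1}(s)=-\varepsilon_i k_{i-1}(s)\ (2\le i\le n),$$ and all other entries $0$. Let $$M(s)=\xi A(s)+\xi^{(2)}A(s)+\cdots+\xi^{(p)}A(s)+\cdots,$$ where $\xi A(s)=\xi^{(1)}A(s)=\int_0^s A(\sigma)\,d\sigma$ and $\xi^{(p)}A(s)=\int_0^s A(\sigma)\,\xi^{(p-1)}A(\sigma)\,d\sigma$ for $p>1$, and let $m_{ij}(s)$ denote the entries of $M(s)$. Then $x$ is a periodic curve of period $\omega$ (that is, $x(s+\omega)=x(s)$ for all $s$) if and only if both of the following hold: (i) the matrix $M(\omega)$ is the zero matrix; (ii) $$\omega+\int_0^\omega m_{11}(s)\,ds=\int_0^\omega m_{12}(s)\,ds=\int_0^\omega m_{13}(s)\,ds=\cdots=\int_0^\omega m_{1n}(s)\,ds=0.$$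
   Context: The Minkowski space-time $E_v^n$ is $\mathbb{R}^n$ with the flat metric $\langle\cdot,\cdot\rangle=-\sum_{i=1}^{v}dx_i^2+\sum_{i=v+1}^{n}dx_i^2$. A vector $\vec w$ is null if $\langle \vec w,\vec w\rangle=0$ and $\vec w\ne0$; a unit vector satisfies $\langle\vec w,\vec w\rangle=\pm1$. A curve $x$ is unit speed (parametrized by pseudo-arclength) if $\langle x'(s),x'(s)\rangle=1$ for all $s$ (spacelike curve) or $\langle x'(s),x'(s)\rangle=-1$ for all $s$ (timelike curve). Standing assumptions: $x$ is a regular (sufficiently smooth) curve such that, for every $s$, the vectors $x'(s),x''(s),\dots,x^{(n)}(s)$ are linearly independent and non-null, and an orthonormal system $\{\vec V_1(s),\dots,\vec V_n(s)\}$ (with $\langle \vec V_i,\vec V_j\rangle=0$ for $i\neq j$ and $\langle \vec V_i,\vec V_i\rangle=\varepsilon_i=\pm1$) is obtained from them by orthonormalization, with $\vec V_1=x'$. This system is called the Serre-Frenet frame of $x$. The curvatures $k_1,\dots,k_{n-1}$ are the functions for which the following derivative formulae hold: $$\vec V_1'=\varepsilon_1k_1\vec V_2,\qquad \vec V_i'=-\varepsilon_ik_{i-1}\vec V_{i-1}+\varepsilon_ik_i\vec V_{i+1}\ (1<i<n),\qquad \vec V_n'=-\varepsilon_nk_{n-1}\vec V_{n-1};$$ equivalently $k_i=\varepsilon_i\varepsilon_{i+1}\langle \vec V_i',\vec V_{i+1}\rangle$ for $1\le i\le n-1$. *)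

(* Defs.v *)
From HB Require Import structures.
From mathcomp Require Import all_boot all_order all_algebra.
From mathcomp Require Import all_classical all_reals all_analysis.

Set Implicit Arguments.
Unset Strict Implicit.
Unset Printing Implicit Defensive.

Import Order.TTheory GRing.Theory Num.Theory.
Import numFieldNormedType.Exports.

Local Open Scope classical_set_scope.
Local Open Scope ring_scope.

(* The scalar product of E_v^n: the first v coordinates carry a minus sign. *)
Definition pseudo_dot (R : realType) (v n : nat) (a b : 'rV[R]_n) : R :=
  \sum_(i < n) (if (i < v)%N then - (a 0 i * b 0 i) else a 0 i * b 0 i).

Definition null_vector (R : realType) (v n : nat) (w : 'rV[R]_n) : Prop :=
  pseudo_dot v w w = 0 /\ w <> 0.

Definition unit_speed (R : realType) (v n : nat) (x : R -> 'rV[R]_n) : Prop :=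
  (forall s, pseudo_dot v (derive1 x s) (derive1 x s) = 1) \/
  (forall s, pseudo_dot v (derive1 x s) (derive1 x s) = -1).

(* The ambient dimension is n.+1. Row i of [derivatives x s] is the derivative
   of order i.+1, so the rows are x', x'', ..., x^(n+1). *)
Definition derivatives (R : realType) (n : nat) (x : R -> 'rV[R]_n.+1) (s : R)
    : 'M[R]_n.+1 :=
  \matrix_(i < n.+1) derive1n i.+1 x s.

Definition regular_curve (R : realType) (v n : nat) (x : R -> 'rV[R]_n.+1)
    : Prop :=
  [/\ forall (m : nat) (s : R), (m <= n)%N -> derivable (derive1n m x) s 1,
      forall s, row_free (derivatives x s)
    & forall s (i : 'I_n.+1), ~ null_vector v (row i (derivatives x s))].

(* Orthonormalization is expressed by the equality of the successive spans:
   V_0, ..., V_i span the same subspace as the first i+1 derivatives of x.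
   This leaves the sign of each V_i free, apart from V_0 = x'. *)
Definition serre_frenet_frame (R : realType) (v n : nat)
    (x : R -> 'rV[R]_n.+1) (V : 'I_n.+1 -> R -> 'rV[R]_n.+1)
    (eps : 'I_n.+1 -> R) : Prop :=
  [/\ forall i, eps i = 1 \/ eps i = -1,
      forall s i j, pseudo_dot v (V i s) (V j s) = if i == j then eps i else 0,
      forall s, V ord0 s = derive1 x s
    & forall s (i : 'I_n.+1),
        (\sum_(j < n.+1 | (j <= i)%N) <<V j s>> ==
         \sum_(j < n.+1 | (j <= i)%N) <<row j (derivatives x s)>>)%MS].

(* With indices starting at 0, the curvatures are k 0, ..., k n.-1 (the later
   values of k are never used); V_i' = - eps_i k_(i-1) V_(i-1)
   + eps_i k_i V_(i+1), the first term being absent for i = 0 and the second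
   one for i = n. *)
Definition curvatures (R : realType) (n : nat)
    (V : 'I_n.+1 -> R -> 'rV[R]_n.+1) (eps : 'I_n.+1 -> R)
    (k : nat -> R -> R) : Prop :=
  forall (i : 'I_n.+1) (s : R),
    is_derive s 1 (V i)
      ((if (0 < i)%N then - (eps i * k i.-1 s) *: V (inord i.-1) s else 0) +
       (if (i < n)%N then (eps i * k i s) *: V (inord i.+1) s else 0)).

Definition curvature_matrix (R : realType) (n : nat) (eps : 'I_n.+1 -> R)
    (k : nat -> R -> R) (s : R) : 'M[R]_n.+1 :=
  \matrix_(i, j)
    if j == i.+1 :> nat then eps i * k i s
    else if i == j.+1 :> nat then - (eps i * k i.-1 s)
    else 0.

Definition oriented_integral (R : realType) (a b : R) (f : R -> R) : R :=
  if a <= b then \int[lebesgue_measure]_(t in `[a, b]) f t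
  else - \int[lebesgue_measure]_(t in `[b, a]) f t.

Definition mx_integral (R : realType) (m n : nat) (a b : R)
    (F : R -> 'M[R]_(m, n)) : 'M[R]_(m, n) :=
  \matrix_(i, j) oriented_integral a b (fun t => F t i j).

(* [xi A p.+1] is the (p+1)-fold iterated integral of A. *)
Fixpoint xi (R : realType) (n : nat) (A : R -> 'M[R]_n) (p : nat) (s : R)
    : 'M[R]_n :=
  match p with
  | 0%N => 1%:M
  | q.+1 => mx_integral 0 s (fun t => A t *m xi A q t)
  end.

Definition matrizant_series (R : realType) (n : nat) (A : R -> 'M[R]_n) (s : R)
    : 'M[R]_n :=
  \matrix_(i, j) limn (fun N => \sum_(1 <= p < N) xi A p s i j).

(* Main.v *)
Require Import Defs.
From HB Require Import structures.
From mathcomp Require Import all_boot all_order all_algebra.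
From mathcomp Require Import ring lra.
From mathcomp Require Import all_classical all_reals all_analysis.

Set Implicit Arguments.
Unset Strict Implicit.
Unset Printing Implicit Defensive.

Import Order.TTheory GRing.Theory Num.Theory.
Import numFieldNormedType.Exports.

Local Open Scope classical_set_scope.
Local Open Scope ring_scope.

(** Stack the frame vectors into a matrix [F s], with row [i] equal to [V i s].
    The Frenet formulae become the linear equation [F' = A F] with
    [omega]-periodic [A], and [F s] is invertible because the frame is
    orthonormal for a nondegenerate form. Three facts give the theorem.

    The Peano-Baker series solves the equation: [F s = (1 + M s) F(0)] for
    [0 <= s]. Indeed, after [N] terms the remainder [E_N] of the series
    satisfies [E_(N+1)' = A E_N], so by induction it is dominated on a segment
    by [C (K s)^N / N!] for constants [C] and [K], which tends to [0]
    ([xi_remainder_bound], [matrizant_seriesE]). In particular [M omega = 0]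
    says that [F omega = F 0]. Since [x' = V_0] is the first row of [F],
    integrating gives [x omega - x 0 = w *m F 0], where the row [w] has exactly
    the entries that condition (ii) requires to vanish ([displacementE]); as
    [F 0] is invertible, (ii) means [x omega = x 0].

    If (i) and (ii) hold, [s |-> F (s + omega)] and [F] solve the same equation
    with the same initial value. The matrix [E A] is skew for
    [E = diag (eps i)], so [Phi^T E Psi] is constant for any two solutions,
    which forces them to agree for all [s] ([skew_linear_unique]). Then
    [x (s + omega) - x s] has derivative [0] and vanishes at [0].

    Conversely, let [x] be periodic. Then [V_0 = x'] is periodic, and the Frenet
    formula for [V_i'] passes periodicity from [V_(i-1)] and [V_i] to [V_(i+1)]
    provided that [k_i] never vanishes. That is where the independence of the
    derivatives of [x] enters: the matrix of products of these derivatives with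
    the frame is triangular and invertible, and its consecutive diagonal entries
    have ratio [eps_(i+1) k_i] ([curvature_neq0]). So [F omega = F 0], whence
    (i), and [x omega = x 0], whence (ii). *)

(** * Oriented integrals as antiderivatives *)

Lemma oriented_integralaa (R : realType) (a : R) (f : R -> R) :
  oriented_integral a a f = 0.
Proof. by rewrite /oriented_integral lexx set_itv1 Rintegral_set1. Qed.

Lemma continuous_integrable_itv (R : realType) (f : R -> R) (a b : R) :
  continuous f -> lebesgue_measure.-integrable `[a, b] (EFin \o f).
Proof.
move=> cf; apply: continuous_compact_integrable; first exact: segment_compact.
exact: continuous_subspaceT.
Qed.

(** Moving the base point to the left of both bounds removes the case
    distinction on their order, so that one-sided results on integrals over
    [`[c, t]] apply to the oriented integral. *)
Lemma oriented_integralB (R : realType) (f : R -> R) (c a b : R) :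
  continuous f -> c <= a -> c <= b ->
  oriented_integral a b f =
  \int[lebesgue_measure]_(t in `[c, b]) f t -
  \int[lebesgue_measure]_(t in `[c, a]) f t.
Proof.
move=> cf; wlog ab : a b / a <= b => [wl ca cb|ca cb].
  have [ab|ba] := leP a b; first exact: wl.
  rewrite -opprB -(wl b a (ltW ba) cb ca) /oriented_integral (ltW ba).
  by rewrite leNgt ba.
rewrite /oriented_integral ab Rintegral_itvB//; last first.
  exact: continuous_integrable_itv.
rewrite Rintegral_itv_obnd_cbnd//.
apply: integrableS (continuous_integrable_itv a b cf) => //.
exact: subset_itv_oc_cc.
Qed.

Lemma is_derive_oriented_integral (R : realType) (f : R -> R) (a s : R) :
  continuous f -> is_derive s 1 (fun t => oriented_integral a t f) (f s).
Proof.
move=> cf.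
(* A base point strictly to the left of [a] and [s] serves all [t] near [s]. *)
pose c := Num.min a s - 1.
have ma : Num.min a s <= a by rewrite ge_min lexx.
have ms : Num.min a s <= s by rewrite ge_min lexx orbT.
have ca : c < a by rewrite /c; lra.
have cs : c < s by rewrite /c; lra.
have ss : s < s + 1 by lra.
have [|d de] := continuous_FTC1 ss
  (continuous_integrable_itv c (s + 1) cf) _ (@cf s).
  exact: cs.
have dF : is_derive s 1
    (fun t => \int[lebesgue_measure]_(u in `[c, t]) f u -
              \int[lebesgue_measure]_(u in `[c, a]) f u) (f s).
  rewrite -[f s]subr0 -de derive1E; apply: is_deriveB.
  exact/derivableP.
apply: near_eq_is_derive dF; near=> t.
rewrite (oriented_integralB cf (ltW ca))//; near: t.
exact: lt_le_nbhsr.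
Unshelve. all: by end_near. Qed.

(** * Derivatives of matrix-valued functions *)

Lemma is_derive_mxP (R : realType) (m n : nat) (F : R -> 'M[R]_(m, n))
    (s : R) (D : 'M[R]_(m, n)) :
  is_derive s 1 F D <-> forall i j, is_derive s 1 (fun t => F t i j) (D i j).
Proof.
split=> [[dF <-] i j|dF].
  rewrite derive_mx// mxE; apply/derivableP.
  by move/derivable_mxP : dF.
have dF' : derivable F s 1 by apply/derivable_mxP => i j.
apply: DeriveDef => //; rewrite derive_mx//; apply/matrixP => i j.
by rewrite mxE derive_val.
Qed.

Lemma is_derive_mulmx (R : realType) (m n p : nat) (F : R -> 'M[R]_(m, n))
    (G : R -> 'M[R]_(n, p)) (s : R) (dF : 'M[R]_(m, n)) (dG : 'M[R]_(n, p)) :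
  is_derive s 1 F dF -> is_derive s 1 G dG ->
  is_derive s 1 (fun t => F t *m G t) (dF *m G s + F s *m dG).
Proof.
move=> /is_derive_mxP hF /is_derive_mxP hG; apply/is_derive_mxP => i k.
rewrite !mxE -big_split/=.
rewrite [X in is_derive _ _ X](_ : _ = \sum_j (fun t => F t i j * G t j k)).
  apply: is_derive_sum => j.
  rewrite addrC [dF i j * _]mulrC.
  exact: is_deriveM.
by apply/funext => t; rewrite mxE fct_sumE.
Qed.

Lemma is_derive_mulmxr (R : realType) (m n p : nat) (F : R -> 'M[R]_(m, n))
    (B : 'M[R]_(n, p)) (s : R) (D : 'M[R]_(m, n)) :
  is_derive s 1 F D -> is_derive s 1 (fun t => F t *m B) (D *m B).
Proof.
move=> dF; have := is_derive_mulmx dF (is_derive_cst B s 1).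
by rewrite mulmx0 addr0.
Qed.

Lemma is_derive_mx_cst (R : realType) (m n : nat) (F : R -> 'M[R]_(m, n))
    (s t : R) :
  (forall u : R, is_derive u 1 F 0) -> F s = F t.
Proof.
move=> dF; apply/matrixP => i j.
apply: (@is_derive_0_is_cst _ (fun u => F u i j)) => u.
by have /is_derive_mxP/(_ i j) := dF u; rewrite mxE.
Qed.

Lemma is_derive_continuous (R : realType) (f df : R -> R) :
  (forall s : R, is_derive s 1 f (df s)) -> continuous f.
Proof.
move=> hf s; apply: differentiable_continuous; apply/derivable1_diffP.
exact: ex_derive.
Qed.

Lemma is_derive_mx_integral (R : realType) (m n : nat) (a s : R)
    (F : R -> 'M[R]_(m, n)) :
  (forall i j, continuous (fun t => F t i j)) ->
  is_derive s 1 (fun t => mx_integral a t F) (F s).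
Proof.
move=> cF; apply/is_derive_mxP => i j.
under eq_fun do rewrite mxE.
exact: is_derive_oriented_integral.
Qed.

Lemma is_derive_trmx (R : realType) (m n : nat) (F : R -> 'M[R]_(m, n))
    (s : R) (D : 'M[R]_(m, n)) :
  is_derive s 1 F D -> is_derive s 1 (fun t => (F t)^T) D^T.
Proof.
move=> /is_derive_mxP dF; apply/is_derive_mxP => i j; rewrite mxE.
by under eq_fun do rewrite mxE.
Qed.

Lemma is_derive_translate (R : realType) (m n : nat) (F : R -> 'M[R]_(m, n))
    (s c : R) (D : 'M[R]_(m, n)) :
  is_derive (s + c) 1 F D -> is_derive s 1 (fun t => F (t + c)) D.
Proof.
move=> /is_derive_mxP dF; apply/is_derive_mxP => i j.
rewrite -[D i j]mulr1.
exact: (@is_derive1_comp _ (fun t => F t i j) (shift c) s _ _ (dF i j)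
  (is_derive_shift s 1 c)).
Qed.

Lemma is_derive_mx_unique (R : realType) (m n : nat) (F : R -> 'M[R]_(m, n))
    (s : R) (D D' : 'M[R]_(m, n)) :
  is_derive s 1 F D -> is_derive s 1 F D' -> D = D'.
Proof. by move=> [_ <-] [_ <-]. Qed.

Lemma mx_integralaa (R : realType) (m n : nat) (a : R) (F : R -> 'M[R]_(m, n)) :
  mx_integral a a F = 0.
Proof. by apply/matrixP => i j; rewrite !mxE oriented_integralaa. Qed.

Lemma continuous_mulmx (R : realType) (m n p : nat) (F : R -> 'M[R]_(m, n))
    (G : R -> 'M[R]_(n, p)) :
  (forall i j, continuous (fun t => F t i j)) ->
  (forall i j, continuous (fun t => G t i j)) ->
  forall i j, continuous (fun t => (F t *m G t) i j).
Proof.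
move=> cF cG i k; under eq_fun do rewrite mxE.
apply: continuous_big => [|j _ s]; first exact: add_continuous.
by apply: cvgM; [exact: cF|exact: cG].
Qed.

(** Both [g + f] and [g - f] are nondecreasing and start at [0]. *)
Lemma le_norm_derive (R : realType) (f df g dg : R -> R) (T : R) :
  (forall s : R, is_derive s 1 f (df s)) ->
  (forall s : R, is_derive s 1 g (dg s)) ->
  (forall s, 0 <= s <= T -> `|df s| <= dg s) ->
  f 0 = 0 -> g 0 = 0 ->
  forall s, 0 <= s <= T -> `|f s| <= g s.
Proof.
move=> hf hg hfg f0 g0 s sT.
have mono h (dh : R -> R) : (forall s : R, is_derive s 1 h (dh s)) -> h 0 = 0 ->
    (forall s, 0 <= s <= T -> 0 <= dh s) -> 0 <= h s.
  move=> hh h0 dh0; rewrite -h0.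
  case/andP: sT => s0 sT.
  apply: (@ger0_derive1_ndecr _ h 0 T) => // [u|].
  - rewrite in_itv/= => /andP[u0 uT].
    by rewrite derive1E derive_val dh0 ?ltW//= ltW.
  - apply: continuous_subspaceT; exact: is_derive_continuous hh.
rewrite ler_norml -subr_ge0 -[_ <= g s]subr_ge0 opprK; apply/andP; split.
  apply: (mono (f + g) (df + dg)) => [|u /hfg].
    by rewrite [LHS](_ : _ = f 0 + g 0)// f0 g0 addr0.
  rewrite ler_norml => /andP[lo up].
  by rewrite [leRHS](_ : _ = df u + dg u)//; lra.
apply: (mono (g - f) (dg - df)) => [|u /hfg].
  by rewrite [LHS](_ : _ = g 0 - f 0)// f0 g0 subr0.
rewrite ler_norml => /andP[lo up].
by rewrite [leRHS](_ : _ = dg u - df u)//; lra.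
Qed.

Lemma continuous_mx_bounded (R : realType) (m n : nat) (F : R -> 'M[R]_(m, n))
    (a b : R) :
  (forall i j, continuous (fun t => F t i j)) ->
  exists C, forall s i j, a <= s <= b -> `|F s i j| <= C.
Proof.
move=> cF; have [ab|ba] := leP a b; last first.
  exists 0 => s i j /andP[au ub].
  by have := le_trans au ub; rewrite leNgt ba.
have bd i j : {C | forall s, a <= s <= b -> `|F s i j| <= C}.
  apply: cid; have [|c _ hc] := @EVT_max _ (fun t => `|F t i j|) _ _ ab.
    by apply: continuous_subspaceT => s; apply: cvg_norm; exact: cF.
  by exists `|F c i j| => s sab; apply: hc; rewrite in_itv.
exists (\sum_i \sum_j `|sval (bd i j)|) => s i j sab.
apply: le_trans (svalP (bd i j) s sab) _.
apply: le_trans (ler_norm _) _.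
rewrite (bigD1 i)//= (bigD1 j)//= -addrA lerDl addr_ge0//.
  exact: sumr_ge0.
by apply: sumr_ge0 => *; apply: sumr_ge0.
Qed.

(** * The Peano-Baker series of a linear differential equation *)

Lemma is_derive_xi (R : realType) (n : nat) (A : R -> 'M[R]_n) (p : nat)
    (s : R) :
  (forall i j, continuous (fun t => A t i j)) ->
  is_derive s 1 (xi A p.+1) (A s *m xi A p s).
Proof.
move=> cA; elim: p s => [|p IH] s /=; apply: is_derive_mx_integral.
  by apply: continuous_mulmx => // i j; exact: cst_continuous.
apply: continuous_mulmx => // i j; apply: is_derive_continuous => u.
by have /is_derive_mxP/(_ i j) := IH u.
Qed.

Definition xi_remainder (R : realType) (n m : nat) (A : R -> 'M[R]_n)
    (Phi : R -> 'M[R]_(n, m)) (N : nat) (s : R) : 'M[R]_(n, m) :=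
  Phi s - (\sum_(p < N) xi A p s) *m Phi 0.

(** The partial sums [S_N] of the series satisfy [S_(N+1)' = A S_N], each term
    being the antiderivative of [A] times the preceding one. *)
Lemma is_derive_xi_remainder (R : realType) (n m : nat) (A : R -> 'M[R]_n)
    (Phi : R -> 'M[R]_(n, m)) (N : nat) (s : R) :
  (forall i j, continuous (fun t => A t i j)) ->
  (forall t : R, is_derive t 1 Phi (A t *m Phi t)) ->
  is_derive s 1 (xi_remainder A Phi N.+1) (A s *m xi_remainder A Phi N s).
Proof.
move=> cA dPhi.
have dS : is_derive s 1 (fun t => \sum_(p < N.+1) xi A p t)
    (\sum_(p < N) A s *m xi A p s).
  rewrite [X in is_derive _ _ X](_ : _ =
    cst 1%:M + \sum_(p < N) xi A p.+1); last first.
    by apply/funext => t; rewrite big_ord_recl fctE fct_sumE.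
  rewrite -[X in is_derive _ _ _ X]add0r; apply: is_deriveD.
  by apply: is_derive_sum => p; exact: is_derive_xi.
have dP := is_derive_mulmxr (Phi 0) dS.
rewrite -mulmx_sumr -mulmxA in dP.
rewrite /xi_remainder mulmxBr; exact: is_deriveB.
Qed.

Lemma xi_remainder0 (R : realType) (n m : nat) (A : R -> 'M[R]_n)
    (Phi : R -> 'M[R]_(n, m)) (N : nat) : xi_remainder A Phi N.+1 0 = 0.
Proof.
rewrite /xi_remainder big_ord_recl/= big1 => [|p _]; last first.
  by rewrite /bump/= mx_integralaa.
by rewrite addr0 mul1mx subrr.
Qed.

(** Induction on [N] through [le_norm_derive]: an entry of [A E_N] is a sum of
    [n] products, hence the factor [n%:R * K] gained at each step. *)
Lemma xi_remainder_bound (R : realType) (n m : nat) (A : R -> 'M[R]_n)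
    (Phi : R -> 'M[R]_(n, m)) (T K C : R) :
  (forall i j, continuous (fun t => A t i j)) ->
  (forall t : R, is_derive t 1 Phi (A t *m Phi t)) ->
  (forall s i j, 0 <= s <= T -> `|A s i j| <= K) ->
  (forall s i j, 0 <= s <= T -> `|Phi s i j| <= C) ->
  forall N s i j, 0 <= s <= T ->
    `|xi_remainder A Phi N s i j| <= C * exp_coeff (n%:R * K * s) N.
Proof.
move=> cA dPhi AK PhiC; elim=> [|N IH] s i j sT.
  by rewrite /xi_remainder big_ord0 mul0mx subr0 exp_coeffE/= fact0 expr0 !mulr1
             invr1 mulr1 PhiC.
pose c := C * (n%:R * K) ^+ N.+1 / N.+1`!%:R.
rewrite exp_coeffE /= exprMn_comm; last exact: mulrC.
rewrite (_ : C * _ = c * s ^+ N.+1); last by rewrite /c; ring.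
pose dg t := n%:R * K * (C * exp_coeff (n%:R * K * t) N).
apply: (@le_norm_derive _ (fun t => xi_remainder A Phi N.+1 t i j)
  (fun t => (A t *m xi_remainder A Phi N t) i j) (fun t => c * t ^+ N.+1) dg
  T) => // [t|t|t tT||].
- by have /is_derive_mxP/(_ i j) := is_derive_xi_remainder N t cA dPhi.
- rewrite (_ : dg t = c *: (N.+1%:R * t ^+ N *: 1)).
    have := is_deriveZ c (is_deriveX N.+1 (is_derive_id t 1)).
    by congr is_derive; apply/funext => u; rewrite /= exprfctE.
  rewrite /dg/c exp_coeffE /= factS natrM exprMn_comm; last exact: mulrC.
  rewrite /GRing.scale/= exprS.
  have N0 : (N.+1%:R : R) != 0 by rewrite pnatr_eq0.
  have F0 : (N`!%:R : R) != 0 by rewrite pnatr_eq0 -lt0n fact_gt0.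
  by field; rewrite F0 addrC natr1 N0.
- rewrite mxE (le_trans (ler_norm_sum _ _ _))//.
  apply: (@le_trans _ _ (\sum_(k < n) K * (C * exp_coeff (n%:R * K * t) N))).
    by apply: ler_sum => k _; rewrite normrM ler_pM// ?AK ?IH.
  by rewrite sumr_const card_ord -[leLHS]mulr_natl /dg mulrA.
- by rewrite xi_remainder0 mxE.
- by rewrite expr0n mulr0.
Qed.

(** Since the remainder tends to [0], the existence of the solution [Phi] makes
    the series applied to [Phi 0] converge, with sum [Phi s]. *)
Lemma cvg_xi_sum (R : realType) (n m : nat) (A : R -> 'M[R]_n)
    (Phi : R -> 'M[R]_(n, m)) (s : R) :
  (forall i j, continuous (fun t => A t i j)) ->
  (forall t : R, is_derive t 1 Phi (A t *m Phi t)) -> 0 <= s ->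
  forall i j, ((\sum_(p < N) xi A p s) *m Phi 0) i j @[N --> \oo] --> Phi s i j.
Proof.
move=> cA dPhi s0 i j.
have cPhi k l : continuous (fun t => Phi t k l).
  apply: is_derive_continuous => t.
  by have /is_derive_mxP/(_ k l) := dPhi t.
have [K AK] := continuous_mx_bounded 0 s cA.
have [C PhiC] := continuous_mx_bounded 0 s cPhi.
have ss : 0 <= s <= s by rewrite s0 lexx.
have bd N := xi_remainder_bound cA dPhi AK PhiC N i j ss.
have E0 : xi_remainder A Phi N s i j @[N --> \oo] --> (0 : R).
  apply/norm_cvg0P.
  apply: (@squeeze_cvgr _ _ _ _ (cst 0)
    (fun N => C * exp_coeff (n%:R * K * s) N)).
  - by apply: nearW => N; rewrite normr_ge0 bd.
  - exact: cvg_cst.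
  - rewrite -[X in _ --> X](mulr0 C); apply: cvgM; first exact: cvg_cst.
    exact/cvg_series_cvg_0/is_cvg_series_exp_coeff.
rewrite -[X in _ --> X](subr0) (_ : (fun N => _) =
    (fun N => Phi s i j - xi_remainder A Phi N s i j)).
  by apply: cvgB => //; exact: cvg_cst.
apply/funext => N; rewrite /xi_remainder [in RHS]mxE [X in _ - (_ + X)]mxE.
by rewrite opprB addrC subrK.
Qed.

(** Normalizing the solution by [invmx (Phi 0)] gives it the initial value [1],
    so that [cvg_xi_sum] yields the series itself; its term of index [0] is the
    subtracted identity. *)
Lemma matrizant_seriesE (R : realType) (n : nat) (A Phi : R -> 'M[R]_n)
    (s : R) :
  (forall i j, continuous (fun t => A t i j)) ->
  (forall t : R, is_derive t 1 Phi (A t *m Phi t)) ->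
  Phi 0 \in unitmx -> 0 <= s ->
  matrizant_series A s = Phi s *m invmx (Phi 0) - 1%:M.
Proof.
move=> cA dPhi u0 s0.
have dPsi (t : R) : is_derive t 1 (fun u => Phi u *m invmx (Phi 0))
    (A t *m (Phi t *m invmx (Phi 0))).
  by rewrite mulmxA; exact: is_derive_mulmxr.
have cv := @cvg_xi_sum _ _ _ _ _ s cA dPsi s0.
apply/matrixP => i j; rewrite [LHS]mxE [RHS]mxE [X in _ + X]mxE.
apply: cvg_lim => //; rewrite -cvg_shiftS /=.
rewrite (_ : (fun N => _) = (fun N =>
    ((\sum_(p < N.+1) xi A p s) *m (Phi 0 *m invmx (Phi 0))) i j -
    (1%:M : 'M[R]_n) i j)).
  apply: cvgB; last exact: cvg_cst.
  by have := cv i j; rewrite -cvg_shiftS.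
apply/funext => N /=; rewrite mulmxV// mulmx1 big_ord_recl /= mxE summxE.
by rewrite addrAC subrr add0r big_add1 /= big_mkord.
Qed.

(** * Uniqueness for skew linear equations *)

(** The skewness of [E A] makes [Phi^T E Xi] constant for every solution [Xi];
    comparing [Xi = Phi] with [Xi = Psi] and cancelling the invertible
    [Phi^T E] gives the equality. Unlike the series, this argument treats
    negative and positive times alike. *)
Lemma skew_linear_unique (R : realType) (n : nat) (E : 'M[R]_n)
    (A Phi Psi : R -> 'M[R]_n) :
  (forall s, (A s)^T *m E + E *m A s = 0) -> E \in unitmx ->
  (forall s : R, is_derive s 1 Phi (A s *m Phi s)) ->
  (forall s : R, is_derive s 1 Psi (A s *m Psi s)) ->
  (forall s, Phi s \in unitmx) -> Phi 0 = Psi 0 ->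
  forall s, Phi s = Psi s.
Proof.
move=> skew uE dPhi dPsi uPhi eq0 s.
have cst (Xi : R -> 'M[R]_n) : (forall s : R, is_derive s 1 Xi (A s *m Xi s)) ->
    (Phi s)^T *m E *m Xi s = (Phi 0)^T *m E *m Xi 0.
  move=> dXi; apply: (@is_derive_mx_cst _ _ _
    (fun t => (Phi t)^T *m E *m Xi t)) => t.
  have dPE := is_derive_mulmxr E (is_derive_trmx (dPhi t)).
  have := is_derive_mulmx dPE (dXi t).
  rewrite [X in is_derive _ _ _ X](_ : _ =
    (Phi t)^T *m ((A t)^T *m E + E *m A t) *m Xi t).
    by rewrite skew mulmx0 mul0mx.
  by rewrite trmx_mul mulmxDr mulmxDl !mulmxA.
have := cst _ dPsi; rewrite -eq0 -(cst _ dPhi) -!mulmxA => /esym.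
have uPT : (Phi s)^T \in unitmx by rewrite unitmx_tr.
by move=> /(can_inj (mulKmx uPT))/(can_inj (mulKmx uE)).
Qed.

(** * The frame as the solution of a skew linear equation *)

Definition frame_mx (R : realType) (n : nat) (V : 'I_n -> R -> 'rV[R]_n)
    (s : R) : 'M[R]_n := \matrix_i V i s.

Definition signature_mx (R : realType) (v n : nat) : 'M[R]_n :=
  diag_mx (\row_(i < n) if (i < v)%N then -1 else 1).

Lemma pseudo_dotE (R : realType) (v n : nat) (a b : 'rV[R]_n) :
  pseudo_dot v a b = (a *m signature_mx R v n *m b^T) 0 0.
Proof.
rewrite mxE; apply: eq_bigr => i _; rewrite mul_mx_diag !mxE.
by case: ifP; rewrite ?mulrN1 ?mulNr ?mulr1.
Qed.

Lemma sign_diag_mxK (R : realType) (n : nat) (e : 'rV[R]_n) :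
  (forall i, e 0 i = 1 \/ e 0 i = -1) -> diag_mx e *m diag_mx e = 1%:M.
Proof.
move=> e1; rewrite mul_diag_mx; apply/matrixP => i j; rewrite !mxE.
case: eqVneq => [->|]; last by rewrite mulr0.
by case: (e1 j) => ->; rewrite mulr1n ?mulr1 // mulrNN mulr1.
Qed.

Lemma signature_mx_unit (R : realType) (v n : nat) :
  signature_mx R v n \in unitmx.
Proof.
apply: (proj1 (mulmx1_unit (sign_diag_mxK _))) => i; rewrite mxE.
by case: ifP; [right|left].
Qed.

Lemma sum_ord_eq (R : realType) (n m : nat) (F : 'I_n.+1 -> R) :
  \sum_(j < n.+1) (if j == m :> nat then F j else 0) =
  if (m <= n)%N then F (inord m) else 0.
Proof.
rewrite -big_mkcond; case: leqP => mn.
  by apply: big_pred1 => j; rewrite /= -val_eqE /= inordK.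
by apply: big_pred0 => j; rewrite ltn_eqF// (leq_ltn_trans _ mn)// -ltnS.
Qed.

Lemma is_derive_frame_mx (R : realType) (n : nat)
    (V : 'I_n.+1 -> R -> 'rV[R]_n.+1) (eps : 'I_n.+1 -> R) (k : nat -> R -> R)
    (s : R) :
  curvatures V eps k ->
  is_derive s 1 (frame_mx V) (curvature_matrix eps k s *m frame_mx V s).
Proof.
move=> hV; apply/is_derive_mxP => i a.
under eq_fun do rewrite mxE.
have /is_derive_mxP/(_ 0 a) := hV i s.
congr is_derive; rewrite [RHS]mxE.
(* Row [i] of the curvature matrix is split into its subdiagonal and its
   superdiagonal entry; [i.-1] is guarded at [i = 0]. *)
transitivity (\sum_(j < n.+1) ((if j == i.-1 :> nat then
      (if (0 < i)%N then - (eps i * k i.-1 s) * V j s 0 a else 0) else 0) +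
    (if j == i.+1 :> nat then eps i * k i s * V j s 0 a else 0))).
  rewrite big_split/= !sum_ord_eq (leq_trans (leq_pred _) (leq_ord i)) !mxE.
  by congr (_ + _); case: ifP; rewrite mxE.
apply: eq_bigr => j _; rewrite !mxE.
case: (eqVneq (j : nat) i.+1) => [->|_].
  rewrite gtn_eqF ?add0r// ltnS; exact: leq_pred.
rewrite addr0; case: (posnP i) => [->|i0].
  by rewrite eq_sym /= eqE /= mul0r; case: ifP.
have -> : (i == j.+1 :> nat) = (j == i.-1 :> nat).
  by rewrite -{1}(prednK i0) eqSS eq_sym.
by case: ifP; rewrite ?mul0r.
Qed.

Lemma curvature_matrix_skew (R : realType) (n : nat) (eps : 'I_n.+1 -> R)
    (k : nat -> R -> R) (s : R) :
  (forall i, eps i = 1 \/ eps i = -1) ->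
  let E := diag_mx (\row_i eps i) in
  (curvature_matrix eps k s)^T *m E + E *m curvature_matrix eps k s = 0.
Proof.
move=> e1 /=; have ee i : eps i * eps i = 1.
  by case: (e1 i) => ->; rewrite ?mulr1// mulrNN mulr1.
rewrite mul_diag_mx mul_mx_diag; apply/matrixP => i j; rewrite !mxE.
case: (eqVneq (i : nat) j.+1) => [ij|nij].
  by rewrite ij ltn_eqF//= mulrAC ee mulrN mulrA ee subrr.
case: (eqVneq (j : nat) i.+1) => [ji|]; last by rewrite mul0r mulr0 addr0.
by rewrite ji /= mulNr mulrAC ee mulrA ee addNr.
Qed.

Lemma mulmx_row_col (R : realType) (m n p : nat) (A : 'M[R]_(m, n))
    (B : 'M[R]_(n, p)) i j :
  (A *m B) i j = (row i A *m col j B) 0 0.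
Proof. by rewrite !mxE; apply: eq_bigr => l _; rewrite !mxE. Qed.

Lemma frame_mx_gram (R : realType) (v n : nat)
    (V : 'I_n -> R -> 'rV[R]_n) (eps : 'I_n -> R) (s : R) :
  (forall i j, pseudo_dot v (V i s) (V j s) = if i == j then eps i else 0) ->
  frame_mx V s *m signature_mx R v n *m (frame_mx V s)^T =
  diag_mx (\row_i eps i).
Proof.
move=> VV; apply/matrixP => i j.
rewrite mulmx_row_col row_mul -tr_row !rowK -pseudo_dotE VV !mxE.
by case: eqP => // ->.
Qed.

Lemma frame_mx_unit (R : realType) (v n : nat)
    (V : 'I_n -> R -> 'rV[R]_n) (eps : 'I_n -> R) (s : R) :
  (forall i, eps i = 1 \/ eps i = -1) ->
  (forall i j, pseudo_dot v (V i s) (V j s) = if i == j then eps i else 0) ->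
  frame_mx V s \in unitmx.
Proof.
move=> e1 /frame_mx_gram gram.
have := @sign_diag_mxK _ _ (\row_i eps i) _; rewrite -{1}gram -!mulmxA => E1.
apply: (proj1 (mulmx1_unit (E1 _))) => i; rewrite mxE; exact: e1.
Qed.

Lemma curvature_matrix_continuous (R : realType) (n : nat)
    (eps : 'I_n.+1 -> R) (k : nat -> R -> R) :
  (forall i, (i < n)%N -> continuous (k i)) ->
  forall i j, continuous (fun t => curvature_matrix eps k t i j).
Proof.
move=> kc i j; under eq_fun do rewrite mxE.
case: eqP => [ji|_].
  have ltin : (i < n)%N by rewrite -ltnS -ji.
  by move=> s; apply: cvgM; [exact: cvg_cst|exact: kc].
case: eqP => [ij|_]; last exact: cst_continuous.
have ltjn : (i.-1 < n)%N by rewrite ij /= -ltnS -ij.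
by move=> s; apply: cvgN; apply: cvgM; [exact: cvg_cst|exact: kc].
Qed.

Lemma curvature_matrix_periodic (R : realType) (n : nat)
    (eps : 'I_n.+1 -> R) (k : nat -> R -> R) (omega : R) :
  (forall i, (i < n)%N -> periodic (k i) omega) ->
  periodic (curvature_matrix eps k) omega.
Proof.
move=> kp s; apply/matrixP => i j; rewrite !mxE.
case: eqP => [ji|_]; first by rewrite kp// -ltnS -ji.
by case: eqP => [ij|//]; rewrite kp// ij /= -ltnS -ij.
Qed.

(** * Nonvanishing of the curvatures *)

(** Up to the signs [eps j], the entries are the coordinates of the derivatives
    of [x] in the frame. *)
Definition frenet_coord (R : realType) (v n : nat) (x : R -> 'rV[R]_n.+1)
    (V : 'I_n.+1 -> R -> 'rV[R]_n.+1) (s : R) :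
    'M[R]_n.+1 :=
  derivatives x s *m (signature_mx R v n.+1 *m (frame_mx V s)^T).

Lemma frenet_frame_unit (R : realType) (v n : nat) (x : R -> 'rV[R]_n.+1)
    (V : 'I_n.+1 -> R -> 'rV[R]_n.+1) (eps : 'I_n.+1 -> R) (s : R) :
  serre_frenet_frame v x V eps -> frame_mx V s \in unitmx.
Proof. by case=> e1 VV _ _; exact: (frame_mx_unit e1 (VV s)). Qed.

(** The derivative of order [i + 1] lies in the span of [V_0, ..., V_i], hence
    is orthogonal to the later frame vectors. *)
Lemma frenet_coord_trig (R : realType) (v n : nat) (x : R -> 'rV[R]_n.+1)
    (V : 'I_n.+1 -> R -> 'rV[R]_n.+1) (eps : 'I_n.+1 -> R) (s : R) :
  serre_frenet_frame v x V eps -> is_trig_mx (frenet_coord v x V s).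
Proof.
case=> _ VV _ spanV; apply/is_trig_mxP => i j ij.
have /andP[_ subV] := spanV s i.
have : (row i (derivatives x s) <=
    \sum_(j < n.+1 | (j <= i)%N) <<V j s>>)%MS.
  apply: submx_trans subV; apply: (sumsmx_sup i) => //.
  by rewrite genmxE.
move=> /sub_sums_genmxP[u Du].
rewrite /frenet_coord mulmxA mulmx_row_col row_mul -tr_row [row j _]rowK.
rewrite Du !mulmx_suml summxE big1// => l li.
rewrite -!mulmxA [LHS]mxE big1// => o _; rewrite mulmxA ord1 -pseudo_dotE VV.
by rewrite ifF ?mulr0//; apply/negbTE; rewrite neq_ltn (leq_ltn_trans li ij).
Qed.

(** The determinant of this triangular matrix is the product of its diagonal. *)
Lemma frenet_coord_diag_neq0 (R : realType) (v n : nat) (x : R -> 'rV[R]_n.+1)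
    (V : 'I_n.+1 -> R -> 'rV[R]_n.+1) (eps : 'I_n.+1 -> R) (s : R)
    (i : 'I_n.+1) :
  regular_curve v x -> serre_frenet_frame v x V eps ->
  frenet_coord v x V s i i != 0.
Proof.
move=> hx hframe; case: hx => _ /(_ s); rewrite row_free_unit => uD _.
have : frenet_coord v x V s \in unitmx.
  rewrite !unitmx_mul uD signature_mx_unit unitmx_tr.
  exact: frenet_frame_unit hframe.
rewrite unitmxE (det_trig (frenet_coord_trig s hframe)) unitfE.
by move/prodf_neq0 => /(_ i isT).
Qed.

(** The product of the derivative of order [i + 1] with [V_(i+1)] is identically
    [0]. Differentiating it shows that the product of the derivative of order
    [i + 2] with [V_(i+1)] is [eps_(i+1) k_i] times that of the derivative of
    order [i + 1] with [V_i]; both are diagonal entries of [frenet_coord]. *)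
Lemma curvature_neq0 (R : realType) (v n : nat) (x : R -> 'rV[R]_n.+1)
    (V : 'I_n.+1 -> R -> 'rV[R]_n.+1) (eps : 'I_n.+1 -> R) (k : nat -> R -> R)
    (s : R) (i : nat) :
  regular_curve v x -> serre_frenet_frame v x V eps -> curvatures V eps k ->
  (i < n)%N -> k i s <> 0.
Proof.
move=> hx hframe hcurv ltin ki0.
have lein : (i < n.+1)%N by rewrite ltnW.
pose a : 'I_n.+1 := Ordinal lein.
pose b : 'I_n.+1 := Ordinal (ltin : i.+1 < n.+1)%N.
have ddx : is_derive s 1 (derive1n i.+1 x) (row b (derivatives x s)).
  rewrite rowK [X in is_derive _ _ _ X](_ : _ = derive1 (derive1n i.+1 x) s);
    last by rewrite -derive1nS.
  rewrite derive1E; apply/derivableP.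
  by case: hx => + _ _; exact.
have dF := is_derive_trmx (is_derive_frame_mx s hcurv).
have dGF := is_derive_mulmx (is_derive_cst (signature_mx R v n.+1) s 1) dF.
have dP := is_derive_mulmx ddx dGF.
have /is_derive_mxP/(_ 0 b) d1 := dP.
have P0 : (fun t => (derive1n i.+1 x t *m
    (signature_mx R v n.+1 *m (frame_mx V t)^T)) 0 b) = cst 0.
  apply/funext => t.
  have /is_trig_mxP/(_ a b (ltnSn _)) := frenet_coord_trig t hframe.
  rewrite /frenet_coord => <-.
  rewrite -[derive1n i.+1 x t](rowK (fun l : 'I_n.+1 => derive1n l.+1 x t) a).
  by rewrite -row_mul mxE.
have [_ d2] : is_derive s 1 (cst (0 : R)) ((row b (frenet_coord v x V s) +
    row a (frenet_coord v x V s) *m (curvature_matrix eps k s)^T) 0 b).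
  rewrite -P0 /frenet_coord !row_mul [row a _]rowK -!mulmxA -trmx_mul.
  by rewrite mul0mx add0r in d1.
have := frenet_coord_diag_neq0 s b hx hframe.
apply/negP; rewrite negbK; apply/eqP.
have [_ d0] := is_derive_cst (0 : R) s 1.
(* In row [i] of the triangular matrix only the entries [l <= i] survive,
   and row [i + 1] of the curvature matrix meets them only in a multiple of
   [k_i s = 0]. *)
rewrite d0 in d2; rewrite mxE mxE [X in _ + X]mxE big1 ?addr0 in d2 => // l _.
rewrite [X in X * _]mxE [X in _ * X]mxE [X in _ * X]mxE.
have [il|li] := ltnP i l.
  have /is_trig_mxP/(_ a l il) := frenet_coord_trig s hframe.
  by move=> ->; rewrite mul0r.
rewrite ltn_eqF ?(leq_ltn_trans li)//=.
by case: ifP => _; rewrite /= ?ki0 ?mulr0 ?oppr0 ?mulr0.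
Qed.

(** * Periodicity of the frame of a periodic curve *)

Lemma is_derive_periodic (R : realType) (m n : nat) (F : R -> 'M[R]_(m, n))
    (omega s : R) (D D' : 'M[R]_(m, n)) :
  periodic F omega -> is_derive s 1 F D -> is_derive (s + omega) 1 F D' ->
  D' = D.
Proof.
move=> Fp dF /is_derive_translate dF'; apply: is_derive_mx_unique dF' _.
by rewrite (_ : (fun t => _) = F)//; exact/funext.
Qed.

Lemma is_derive_regular_curve (R : realType) (v n : nat) (x : R -> 'rV[R]_n.+1)
    (s : R) :
  regular_curve v x -> is_derive s 1 x (derive1 x s).
Proof.
case=> dx _ _; rewrite derive1E; apply/derivableP.
exact: (dx 0 s (leq0n n)).
Qed.

(** Strong induction along the frame: differentiating the periodicity of [V_m]
    and cancelling the known terms leaves [eps_m k_m V_(m+1)], whose coefficient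
    is periodic and nonzero. *)
Lemma frame_periodic (R : realType) (v n : nat) (x : R -> 'rV[R]_n.+1)
    (V : 'I_n.+1 -> R -> 'rV[R]_n.+1) (eps : 'I_n.+1 -> R)
    (k : nat -> R -> R) (omega : R) :
  regular_curve v x -> serre_frenet_frame v x V eps -> curvatures V eps k ->
  (forall i, (i < n)%N -> periodic (k i) omega) ->
  periodic x omega -> forall i, periodic (V i) omega.
Proof.
move=> hx hframe hcurv kp xp.
have [e1 _ V0 _] := hframe.
suff H m : (m <= n)%N -> forall j, (j <= m)%N -> periodic (V (inord j)) omega.
  by move=> i; rewrite -(inord_val i); exact: (H n (leqnn n) i (leq_ord i)).
elim: m => [_ j|m IH mn j].
  rewrite leqn0 => /eqP -> s; rewrite (_ : inord 0 = ord0); last first.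
    by apply: val_inj; rewrite /= inordK.
  rewrite !V0; apply: (is_derive_periodic xp).
    exact: is_derive_regular_curve hx.
  exact: is_derive_regular_curve hx.
rewrite leq_eqVlt ltnS => /orP[/eqP ->|jm]; last exact: IH (ltnW mn) j jm.
move=> s; have Vp := IH (ltnW mn).
have im : (inord m : 'I_n.+1) = m :> nat by rewrite inordK// ltnS ltnW.
have := is_derive_periodic (Vp m (leqnn m)) (hcurv (inord m) s)
  (hcurv (inord m) (s + omega)).
rewrite im mn (kp m mn).
have -> : (if (0 < m)%N then - (eps (inord m) * k m.-1 (s + omega)) *:
    V (inord m.-1) (s + omega) else 0) =
    (if (0 < m)%N then - (eps (inord m) * k m.-1 s) *:
    V (inord m.-1) s else 0).
  case: ifP => // m0; rewrite kp ?Vp ?leq_pred//.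
  by rewrite (leq_ltn_trans (leq_pred m)).
move=> /addrI /scalerI; apply; rewrite mulf_neq0//.
  by case: (e1 (inord m)) => ->; rewrite ?oppr_eq0 oner_neq0.
exact/eqP/(curvature_neq0 hx hframe hcurv).
Qed.

(** * Displacement along the curve *)

(** The coordinates of [x s - x 0] in the initial frame when [1 + M] is the
    normalized solution of the frame equation. *)
Definition displacement_coord (R : realType) (n : nat)
    (M : R -> 'M[R]_n.+1) (s : R) : 'rV[R]_n.+1 :=
  s *: delta_mx 0 ord0 + mx_integral 0 s (fun t => row ord0 (M t)).

Lemma displacement_coord_eq0 (R : realType) (n : nat) (M : R -> 'M[R]_n.+1)
    (s : R) :
  displacement_coord M s = 0 <->
  s + oriented_integral 0 s (fun t => M t ord0 ord0) = 0 /\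
  forall j : 'I_n.+1, j != ord0 ->
    oriented_integral 0 s (fun t => M t ord0 j) = 0.
Proof.
have E j : displacement_coord M s 0 j =
    s * (j == ord0)%:R + oriented_integral 0 s (fun t => M t ord0 j).
  rewrite !mxE eqxx /=; congr (_ + _); congr oriented_integral.
  by apply/funext => t; rewrite mxE.
split=> [D0|[D0 Dj]].
  split=> [|j j0]; first by have := E ord0; rewrite D0 mxE eqxx mulr1.
  by have := E j; rewrite D0 mxE (negbTE j0) mulr0 add0r.
apply/rowP => j; rewrite E mxE; have [->|j0] := eqVneq j ord0.
  by rewrite mulr1.
by rewrite Dj// mulr0 addr0.
Qed.

Lemma oriented_integral_ext (R : realType) (a b : R) (f g : R -> R) :
  a <= b -> (forall t, a <= t <= b -> f t = g t) ->
  oriented_integral a b f = oriented_integral a b g.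
Proof.
move=> ab fg; rewrite /oriented_integral ab; apply: eq_Rintegral => t.
by rewrite inE /= in_itv; exact: fg.
Qed.

(** The series is only identified with a solution for nonnegative times, so the
    integrand is first replaced by [Q], which is continuous on the whole line;
    then both sides have the same derivative. *)
Lemma displacementE (R : realType) (n : nat) (x : R -> 'rV[R]_n.+1)
    (A Phi : R -> 'M[R]_n.+1) (s : R) :
  (forall i j, continuous (fun t => A t i j)) ->
  (forall t : R, is_derive t 1 Phi (A t *m Phi t)) ->
  (forall t : R, is_derive t 1 x (row ord0 (Phi t))) ->
  Phi 0 \in unitmx -> 0 <= s ->
  x s - x 0 = displacement_coord (matrizant_series A) s *m Phi 0.
Proof.
move=> cA dPhi dx u0 s0.
pose Q (t : R) := row ord0 (Phi t *m invmx (Phi 0) - 1%:M).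
have dPsi (t : R) : is_derive t 1 (fun u => Phi u *m invmx (Phi 0))
    (A t *m Phi t *m invmx (Phi 0)).
  exact: is_derive_mulmxr.
have cQ i j : continuous (fun t => Q t i j).
  have cPsi a b : continuous (fun t => (Phi t *m invmx (Phi 0)) a b).
    apply: is_derive_continuous => t.
    by have /is_derive_mxP/(_ a b) := dPsi t.
  under eq_fun do rewrite mxE mxE [X in _ + X]mxE.
  by move=> t; apply: cvgB; [exact: cPsi|exact: cvg_cst].
pose W t := t *: delta_mx 0 ord0 + mx_integral 0 t Q.
have -> : displacement_coord (matrizant_series A) s = W s.
  congr (_ + _); apply/matrixP => i j; rewrite [LHS]mxE [RHS]mxE.
  apply: oriented_integral_ext => // t /andP[t0 _].
  by rewrite (matrizant_seriesE cA dPhi u0 t0).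
have dW (t : R) : is_derive t 1 W (row ord0 (Phi t *m invmx (Phi 0))).
  rewrite (_ : row ord0 (Phi t *m _) = delta_mx 0 ord0 + Q t); last first.
    by rewrite /Q raddfB /= row1 addrC subrK.
  apply: is_deriveD; last exact: is_derive_mx_integral.
  apply/is_derive_mxP => i j.
  have := is_deriveZ ((delta_mx 0 ord0 : 'rV[R]_n.+1) i j) (is_derive_id t 1).
  rewrite /GRing.scale /= mulr1; congr is_derive; apply/funext => u.
  by rewrite [RHS]mxE /= mulrC.
have d0 (t : R) : is_derive t 1 (fun u => x u - W u *m Phi 0) 0.
  have := is_deriveB (dx t) (is_derive_mulmxr (Phi 0) (dW t)).
  by rewrite -row_mul mulmxKV// subrr.
have W0 : W 0 = 0 by rewrite /W scale0r mx_integralaa addr0.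
have := is_derive_mx_cst s 0 d0; rewrite /= W0 mul0mx subr0 => <-.
by rewrite opprB addrCA subrr addr0.
Qed.

(** * Periodic curves *)

Theorem theorem3p2 (R : realType) (n v : nat) (hv : (v <= n.+1)%N)
    (x : R -> 'rV[R]_n.+1) (V : 'I_n.+1 -> R -> 'rV[R]_n.+1)
    (eps : 'I_n.+1 -> R) (k : nat -> R -> R) (omega : R)
    (hx : regular_curve v x)
    (hspeed : unit_speed v x)
    (hframe : serre_frenet_frame v x V eps)
    (hcurv : curvatures V eps k)
    (homega : 0 < omega)
    (hcont : forall i, (i < n)%N -> continuous (k i))
    (hper : forall i, (i < n)%N -> periodic (k i) omega) :
  let M := matrizant_series (curvature_matrix eps k) in
  periodic x omega <->
  [/\ M omega = 0,
      omega + oriented_integral 0 omega (fun s => M s ord0 ord0) = 0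
    & forall j : 'I_n.+1, j != ord0 ->
        oriented_integral 0 omega (fun s => M s ord0 j) = 0].
Proof.
move=> M; set A := curvature_matrix eps k in M *; set F := frame_mx V.
have [e1 VV V0 _] := hframe.
have cA i j : continuous (fun t => A t i j).
  exact: curvature_matrix_continuous.
have uF s : F s \in unitmx by exact: (frenet_frame_unit s hframe).
have dF (s : R) : is_derive s 1 F (A s *m F s) by exact: is_derive_frame_mx.
have dx (s : R) : is_derive s 1 x (row ord0 (F s)).
  by rewrite rowK V0; exact: is_derive_regular_curve hx.
have ME : M omega = F omega *m invmx (F 0) - 1%:M.
  by apply: matrizant_seriesE => //; exact: ltW.
have xE : x omega - x 0 = displacement_coord M omega *m F 0.
  by apply: displacementE => //; exact: ltW.
split=> [xp|[M0 c0 cj]].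
  have Fp : F omega = F 0.
    apply/row_matrixP => i; rewrite !rowK -[omega]add0r.
    exact: (frame_periodic hx hframe hcurv hper xp).
  have /displacement_coord_eq0[c0 cj] : displacement_coord M omega = 0.
    apply: (can_inj (mulmxK (uF 0))).
    by rewrite mul0mx -xE -[omega]add0r xp subrr.
  by split=> //; rewrite ME Fp mulmxV// subrr.
have D0 : displacement_coord M omega = 0 by apply/displacement_coord_eq0.
have F0 : F 0 = F (0 + omega).
  move: ME; rewrite M0 add0r => /esym/eqP; rewrite subr_eq0 => /eqP FF.
  by rewrite -[F omega](mulmxKV (uF 0)) FF mul1mx.
have Fp : forall s, F s = F (s + omega).
  have skew s := curvature_matrix_skew k s e1.
  apply: (skew_linear_unique skew) => // [|s].
    apply: (proj1 (mulmx1_unit (sign_diag_mxK _))) => i; rewrite mxE; exact: e1.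
  have Ap : A (s + omega) = A s by exact: curvature_matrix_periodic.
  rewrite -/(A s) -Ap.
  exact: (is_derive_translate (dF (s + omega))).
have dxx (s : R) : is_derive s 1 (fun t => x (t + omega) - x t) 0.
  have := is_deriveB (is_derive_translate (dx (s + omega))) (dx s).
  by rewrite -Fp subrr.
move=> s; have := is_derive_mx_cst s 0 dxx.
rewrite add0r xE D0 mul0mx => /eqP; rewrite subr_eq0 => /eqP; exact.
Qed.
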